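(* If $T$ is sufficiently large, then uniformly for all positive integers $\ell$, we have $$\max_{r}\ \Big|\sum_{mk=n\leqslant\sqrt T}\frac{r(m)\overline{r(n)}}{k}(\log k)^{\ell}\Big| \Big/ \Big(\sum_{n\leqslant\sqrt T}|r(n)|^2\Big) \geqslant \frac{e^{\gamma}}{\ell}\cdot\Big(\frac{\ell}{\ell+1}\Big)^{\ell+1}\cdot\Big(\log_2 T-\log_3 T+O(1)\Big)^{\ell+1},$$ where, for given $T$, the maximum is taken over all functions $r:\mathbb{N}\to\mathbb{C}$ for which the denominator $\sum_{n\leqslant\sqrt T}|r(n)|^2$ is not equal to zero. The threshold for $T$ and the bound implicit in $O(1)$ are absolute (independent of $\ell$ and $T$).
   Context: $\mathbb{N}$ is the set of positive integers. The sum over $mk=n\leqslant\sqrt T$ runs over all pairs of positive integers $(m,k)$ with $n:=mk\leqslant\sqrt T$. $\gamma$ is the Euler constant. Notation: $\log_2 T := \log\log T$ and $\log_3 T := \log\log\log T$ (iterated natural logarithms). *)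

(* Defs.v *)
From mathcomp Require Import all_boot all_order all_algebra.
From mathcomp Require Import all_classical all_reals all_analysis.
From mathcomp Require Export complex.

Set Implicit Arguments.
Unset Strict Implicit.
Unset Printing Implicit Defensive.

Import Order.TTheory GRing.Theory Num.Theory.
Import numFieldNormedType.Exports.

Local Open Scope classical_set_scope.
Local Open Scope ring_scope.

Definition euler_gamma (R : realType) : R :=
  limn (fun n : nat => (\sum_(1 <= k < n.+1) k%:R^-1) - ln (n%:R : R)).

(* For T >= 0 and a natural number n, n <= sqrt T iff n <= floor_sqrt T. *)
Definition floor_sqrt (R : realType) (T : R) : nat := Num.truncn (Num.sqrt T).

(* Functions on the positive integers are represented by functions on nat; the
   value at 0 is never used below.  The modulus [normc] is R-valued, whereas
   the generic norm on R[i] takes its values in R[i]. *)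
Definition sqnorm_sum (R : realType) (T : R) (r : nat -> R[i]) : R :=
  \sum_(1 <= n < (floor_sqrt T).+1) ComplexField.Normc.normc (r n) ^+ 2.

(* m k <= sqrt T with m, k >= 1 forces m, k <= sqrt T, so the ranges of m and k
   below lose no pair. *)
Definition resonance_sum (R : realType) (l : nat) (T : R) (r : nat -> R[i]) :
    R[i] :=
  \sum_(1 <= m < (floor_sqrt T).+1)
    \sum_(1 <= k < (floor_sqrt T).+1 | (m * k <= floor_sqrt T)%N)
      r m * conjc (r (m * k)%N) / k%:R * real_complex R (ln (k%:R : R) ^+ l).

Definition resonance_ratio (R : realType) (l : nat) (T : R) (r : nat -> R[i]) :
    R :=
  ComplexField.Normc.normc (resonance_sum l T r) / sqnorm_sum T r.

Definition is_max_ratio (R : realType) (l : nat) (T M : R) : Prop :=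
  (exists2 r : nat -> R[i], sqnorm_sum T r != 0 & resonance_ratio l T r = M) /\
  (forall r : nat -> R[i], sqnorm_sum T r != 0 -> resonance_ratio l T r <= M).

(* Main.v *)
Require Import Defs.
From mathcomp Require Import all_boot all_order all_algebra.
From mathcomp Require Import all_classical all_reals all_analysis.
From mathcomp Require Import ring lra zify.

(** The resonator is the indicator function of the divisors of
    P = prod_(p <= x) p ^ b.  For it the ratio becomes
    sum_k (ln k)^l / k * c(k), where c(k) is the proportion of the divisors m
    of P for which m k still divides P.  All terms are nonnegative, so any of
    them may be dropped.  Multiplying by one prime p <= x pushes at most a
    proportion 1 / (b + 1) of the divisors out of the set, so c(k) >= 99 / 100
    as soon as k is x-smooth and has at most b / 100 prime factors
    ([shift_count_ge]).  Keeping the x-smooth k <= x^2 leaves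
    sum (ln k)^l / k over these k.

    Let S be the sum of 1 / k over the x-smooth k <= x^2.  Since
    sum_(ln k < t) 1 / k <= 1 + t, keeping only ln k >= t gives at least
    t^l (S - 1 - t) ([smooth_log_sum_ge]), and t = l / (l + 1) * (S - 1) turns
    this into (1 / l) (l / (l + 1))^(l+1) (S - 1)^(l+1).

    The sum of 1 / k over all x-smooth k is asymptotic to e^gamma ln x, so the
    method can produce the factor e^(gamma (l+1)), whereas a single e^gamma is
    asked for.  Hence S >= c ln x - O(1) with any constant c such that
    c^2 > e^gamma suffices, for all l >= 1 at once; the excess is proportional
    to ln ln T and absorbs every error term, so that E = 0 works.  The constant
    c = 3 / 2 is enough, because e^gamma <= 41 / 20 < 9 / 4, and it needs no
    upper bound for the number of primes ([smooth_sum_ge]): an integer n <= x^2 that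
    is not x-smooth has a prime factor greater than x, so that the part of
    ln n carried by the primes greater than x is at least ln x.  The average
    over n <= x^2, with weights 1 / n, of the part of ln n carried by the
    primes p <= x is bounded below by Mertens' inequality
    sum_(p^k <= x) ln p / p^k >= ln x - 1, which comes from ln (x!); the
    remainder is 1 / 2 (ln x)^2 + O(ln x), so the integers that are not
    x-smooth contribute at most 1 / 2 ln x + O(1) to
    sum_(n <= x^2) 1 / n >= 2 ln x.

    With x about (ln T)^(99/100) and b of order ln ln T, the modulus
    P <= x ^ (b x) is at most sqrt T, while ln x is about 99 / 100 ln ln T.
    That the supremum of the ratio is attained is compactness of the unit
    sphere in finite dimension ([max_ratio_exists]). *)

Set Implicit Arguments.
Unset Strict Implicit.
Unset Printing Implicit Defensive.

Import Order.TTheory GRing.Theory Num.Theory.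
Import numFieldNormedType.Exports.

Local Open Scope ring_scope.

(** * Harmonic sums and the Euler constant *)

Section Harmonic.
Variable R : realType.
Implicit Types (n : nat).

Definition harm n : R := \sum_(1 <= k < n.+1) k%:R^-1.

Lemma harm0 : harm 0 = 0.
Proof. by rewrite /harm big_geq. Qed.

Lemma harmS n : harm n.+1 = harm n + n.+1%:R^-1.
Proof. by rewrite /harm big_nat_recr. Qed.

Lemma ln_le_sub1 (y : R) : 0 < y -> ln y <= y - 1.
Proof. by move=> y0; have := @le_ln1Dx R (y - 1); rewrite addrCA subrr addr0; apply; lra. Qed.

Lemma lnS_sub_ge n : (0 < n)%N -> (n.+1%:R^-1 : R) <= ln n.+1%:R - ln n%:R.
Proof.
move=> n0; have n0R : 0 < n%:R :> R by rewrite ltr0n.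
have n1R : 0 < n.+1%:R :> R by rewrite ltr0n.
have h := @ln_le_sub1 (n%:R / n.+1%:R) (divr_gt0 n0R n1R).
rewrite ln_div ?posrE // in h.
have e : n%:R / n.+1%:R - 1 = - n.+1%:R^-1 :> R.
  by rewrite -natr1; field; rewrite natr1 gt_eqF.
by rewrite e in h; rewrite lerNr opprB in h.
Qed.

Lemma lnS_sub_le n : (0 < n)%N -> ln n.+1%:R - ln n%:R <= (n%:R^-1 : R).
Proof.
move=> n0; have n0R : 0 < n%:R :> R by rewrite ltr0n.
have n1R : 0 < n.+1%:R :> R by rewrite ltr0n.
have h := @ln_le_sub1 (n.+1%:R / n%:R) (divr_gt0 n1R n0R).
rewrite ln_div ?posrE // in h.
have e : n.+1%:R / n%:R - 1 = n%:R^-1 :> R.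
  by rewrite -natr1; field; rewrite gt_eqF.
by rewrite e in h.
Qed.

Lemma harm_ge n : ln n.+1%:R <= harm n.
Proof.
elim: n => [|n IHn]; first by rewrite harm0 ln1.
by rewrite harmS; have := @lnS_sub_le n.+1 isT; set v := _^-1; lra.
Qed.

Lemma harm_sub_ln_nonincreasing n : (0 < n)%N ->
  harm n.+1 - ln n.+1%:R <= harm n - ln n%:R.
Proof. by move=> n0; rewrite harmS; have := lnS_sub_ge n0; set v := _^-1; lra. Qed.

Lemma harm_le n : (0 < n)%N -> harm n <= 1 + ln n%:R.
Proof.
case: n => // n _; elim: n => [|n IHn].
  by rewrite harmS harm0 ln1 invr1; lra.
by have := @harm_sub_ln_nonincreasing n.+1 isT; lra.
Qed.

Lemma euler_gamma_le n : (0 < n)%N -> euler_gamma R <= harm n - ln n%:R.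
Proof.
case: n => // n _.
pose u m : R := harm m - ln m%:R.
rewrite -[leRHS]/(u n.+1).
have ni : nonincreasing_seq (fun m => u m.+1).
  by apply/nonincreasing_seqP => m; exact: harm_sub_ln_nonincreasing.
have lb : has_lbound (range (fun m => u m.+1)).
  exists 0 => _ [m _ <-]; rewrite /u subr_ge0.
  apply: le_trans (harm_ge m.+1).
  by rewrite ler_ln ?posrE ?ltr0n // ler_nat.
have cu := nonincreasing_is_cvgn ni lb.
have -> : euler_gamma R = limn (fun m => u m.+1).
  apply/cvg_lim => //.
  by move/cvg_ex : cu => [g ug]; rewrite -(cvg_shiftS u) (cvg_lim _ ug).
exact: (nonincreasing_cvgn_ge ni cu n).
Qed.

End Harmonic.

Section LogSums.
Variable R : realType.
Implicit Types (n : nat).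

(** The monotone sequence H_n - ln n already gives the bound at n = 8. *)
Lemma expR_euler_gamma_le : expR (euler_gamma R) <= 41 / 20.
Proof.
have h8 : harm R 8 = 761 / 280.
  by rewrite !harmS harm0; field.
have g8 := @euler_gamma_le R 8 isT; rewrite h8 in g8.
pose y : R := 761 / 280 / 64.
have sq (a b c : R) : 0 <= b -> b <= a -> c <= b ^+ 2 -> c <= a ^+ 2.
  by move=> b0 ba /le_trans; apply; rewrite ler_pXn2r // nnegrE; lra.
(* exp (- H_8) >= (1 - H_8 / 64) ^ 64, the power computed by repeated
   squaring with downward rounding. *)
have e64 : 61 / 1000 <= expR (- y) ^+ 64.
  have -> : expR (- y) ^+ 64 = expR (- y) ^+ 2 ^+ 2 ^+ 2 ^+ 2 ^+ 2 ^+ 2.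
    by rewrite -!exprM.
  apply: (sq _ (2475 / 10000)); [lra| |lra].
  apply: (sq _ (4975 / 10000)); [lra| |lra].
  apply: (sq _ (7055 / 10000)); [lra| |lra].
  apply: (sq _ (84 / 100)); [lra| |lra].
  apply: (sq _ (9167 / 10000)); [lra| |lra].
  apply: (sq _ (9575 / 10000)); [lra| |lra].
  by apply: le_trans (expR_ge1Dx _); rewrite /y; lra.
rewrite -[euler_gamma R]opprK expRN invf_ple ?posrE ?expR_gt0 ?divr_gt0 ?ltr0n //.
have -> : (41 / 20)^-1 = 20 / 41 :> R by field.
apply: (@le_trans _ _ (expR (ln 8%:R - 761 / 280))).
  rewrite expRD lnK ?posrE //.
  have -> : - (761 / 280) = 64%:R * (- y) by rewrite /y; field.
  by rewrite expRM_natl; lra.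
by rewrite ler_expR; lra.
Qed.

Lemma sum_ln_ge n : n%:R * ln n%:R - n%:R <= \sum_(1 <= k < n.+1) ln k%:R :> R.
Proof.
elim: n => [|[|n] IHn].
- by rewrite big_geq // mul0r subr0.
- by rewrite big_nat1 ln1; lra.
rewrite big_nat_recr //=; apply: le_trans (lerD IHn (lexx _)).
have h := @lnS_sub_le R n.+1 isT.
have n0 : 0 < n.+1%:R :> R by rewrite ltr0n.
have : n.+1%:R * (ln n.+2%:R - ln n.+1%:R) <= 1 :> R.
  by rewrite -ler_pdivlMl // mulr1.
have e : n.+2%:R = n.+1%:R + 1 :> R by rewrite natr1.
move: (ln n.+2%:R) (ln n.+1%:R) => a b; rewrite e.
move: (n.+1%:R) => c; lra.
Qed.

(** Comparison with the integral of ln t / t; the term 1 - 1 / n is a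
    telescoping majorant of the accumulated errors, at most 1 / (2 k^2) at
    step k. *)
Lemma sqr_ln_bounds n : (0 < n)%N ->
  \sum_(1 <= k < n.+1) ln k%:R / k%:R <= ln n%:R ^+ 2 / 2 + 1 - n%:R^-1 :> R
  /\ ln n%:R ^+ 2 / 2 <= \sum_(1 <= k < n) ln k%:R / k%:R + 1 - n%:R^-1 :> R.
Proof.
case: n => // n _; elim: n => [|n [IH1 IH2]].
  by rewrite big_nat1 big_geq // ln1 invr1; lra.
have d1 := @lnS_sub_le R n.+1 isT; have d2 := @lnS_sub_ge R n.+1 isT.
have ln0 : 0 <= ln n.+1%:R :> R by rewrite ln_ge0 // ler1n.
rewrite big_nat_recr //= [X in _ /\ _ <= X + _ - _]big_nat_recr //=.
move: IH1 IH2 d1 d2 ln0.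
move: (\sum_(1 <= k < n.+2) _) (\sum_(1 <= k < n.+1) _) => s1 s2.
have c0 : 0 < n.+1%:R^-1 :> R by rewrite invr_gt0 ltr0n.
have e0 : 0 < n.+2%:R^-1 :> R by rewrite invr_gt0 ltr0n.
have ce : n.+1%:R^-1 - n.+2%:R^-1 = n.+1%:R^-1 * n.+2%:R^-1 :> R.
  have : n.+1%:R != 0 :> R by rewrite pnatr_eq0.
  have : n.+2%:R != 0 :> R by rewrite pnatr_eq0.
  by rewrite -(natr1 n.+1); move: (n.+1%:R) => z z1 z0; field; apply/andP.
have c2e : n.+1%:R^-1 <= 2 * n.+2%:R^-1 :> R.
  rewrite -[X in _ <= X * _]invrK -invfM lef_pV2 ?posrE ?mulr_gt0 ?invr_gt0 ?ltr0n //.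
  rewrite mulrC ler_pdivrMr // -natrM ler_nat; lia.
move: c0 e0 ce c2e.
move: (n.+1%:R^-1) (n.+2%:R^-1) (ln n.+1%:R) (ln n.+2%:R) => c e b a.
move=> c0 e0 ce c2e IH1 IH2 d1 d2 b0; split; nra.
Qed.

End LogSums.

(** * Reciprocals of smooth numbers *)

Lemma logn_sum_dvd p n x : prime p -> (0 < n <= x)%N ->
  logn p n = (\sum_(1 <= k < x.+1) (p ^ k %| n))%N.
Proof.
move=> pp /andP[n0 nx]; rewrite logn_count_dvd //.
rewrite [RHS](@big_cat_nat _ _ _ n) //=; last exact: leqW.
rewrite [X in (_ + X)%N]big_nat_cond [X in (_ + X)%N]big1 ?addn0 // => k /andP[/andP[nk _] _].
by rewrite gtnNdvd // (leq_ltn_trans nk) // ltn_expl // prime_gt1.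
Qed.

Section PrimePowers.
Variable R : realType.
Implicit Types (n x p k d N : nat).

(** With the von Mangoldt function, ln n is the sum of Lambda d over the
    divisors d of n; here the prime powers d = p ^ k are restricted to
    p, k <= x.  This discards nothing when n <= x, and for larger n it only
    sees primes up to x. *)
Definition ppow_log x n : R :=
  \sum_(0 <= p < x.+1 | prime p) \sum_(1 <= k < x.+1)
    ln p%:R * (p ^ k %| n)%:R.

Lemma ln_prod_nat (I : Type) (s : seq I) (P : pred I) (F : I -> nat) :
  (forall i, P i -> (0 < F i)%N) ->
  ln (\prod_(i <- s | P i) F i)%N%:R = \sum_(i <- s | P i) ln (F i)%:R :> R.
Proof.
move=> F0.
suff [] : (0 < \prod_(i <- s | P i) F i)%N /\
  ln (\prod_(i <- s | P i) F i)%N%:R = \sum_(i <- s | P i) ln (F i)%:R :> R by [].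
apply: (big_rec2 (fun a b => (0 < a)%N /\ ln a%:R = b)); first by rewrite ln1.
move=> i a b Pi [a0 <-]; rewrite muln_gt0 a0 F0 //; split=> //.
by rewrite natrM lnM // posrE ltr0n // F0.
Qed.

Lemma ln_natX a k : (0 < a)%N -> ln (a ^ k)%N%:R = k%:R * ln a%:R :> R.
Proof. by move=> a0; rewrite natrX lnXn ?ltr0n // mulr_natl. Qed.

Lemma ln_nat_ge0 n : 0 <= ln n%:R :> R.
Proof. by case: n => [|n]; [rewrite ln0 | rewrite ln_ge0 // ler1n]. Qed.

Lemma ppow_log_eq x n : (0 < n <= x)%N -> ppow_log x n = ln n%:R.
Proof.
move=> n0x; have /andP[n0 nx] := n0x.
rewrite -{2}(partnT n0) (widen_partn predT nx) /=.
rewrite ln_prod_nat; last first.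
  by move=> p _; rewrite expn_gt0; case: (posnP p) => [->|//]; rewrite lognE.
rewrite [RHS](bigID (fun p => prime p)) /= [X in _ = _ + X]big1 ?addr0; last first.
  by move=> p /negPf np; rewrite lognE np expn0 ln1.
apply: eq_bigr => p pp; rewrite ln_natX ?prime_gt0 // (logn_sum_dvd pp n0x).
by rewrite natr_sum mulrC mulr_sumr.
Qed.

Lemma ppow_log_le x n : (0 < n)%N -> ppow_log x n <= ln n%:R.
Proof.
move=> n0; rewrite -(@ppow_log_eq (maxn n x) n) ?n0 ?leq_maxl //.
set z := maxn n x; have xz : (x <= z)%N by rewrite leq_maxr.
have term0 p k : 0 <= ln p%:R * (p ^ k %| n)%:R :> R.
  by rewrite mulr_ge0 ?ln_nat_ge0 ?ler0n.
rewrite /ppow_log [leRHS](@big_cat_nat _ _ _ x.+1) //=.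
apply: ler_wpDr; first by apply: sumr_ge0 => p _; apply: sumr_ge0.
apply: ler_sum => p _; rewrite [leRHS](@big_cat_nat _ _ _ x.+1) //=.
by apply: ler_wpDr => //; apply: sumr_ge0.
Qed.

(** The restricted sum for n misses the term of q itself, which is at least
    ln x. *)
Lemma ppow_log_rough x n q : (0 < n)%N -> prime q -> (x < q)%N -> (q %| n)%N ->
  ppow_log x n + ln x%:R <= ln n%:R.
Proof.
move=> n0 pq xq qn.
have q0 := prime_gt0 pq; have qq : (q <= n)%N by apply: dvdn_leq.
rewrite -(@ppow_log_eq n n) ?n0 ?leqnn //.
have xn : (x < n)%N := leq_trans xq qq.
have term0 p k : 0 <= ln p%:R * (p ^ k %| n)%:R :> R.
  by rewrite mulr_ge0 ?ln_nat_ge0 ?ler0n.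
rewrite /ppow_log [leRHS](@big_cat_nat _ _ _ x.+1) //=; last by rewrite ltnS ltnW.
apply: lerD.
  apply: ler_sum => p _; rewrite [leRHS](@big_cat_nat _ _ _ x.+1) //=; last by rewrite ltnS ltnW.
  by apply: ler_wpDr => //; apply: sumr_ge0.
rewrite big_mkcond (bigD1_seq q) ?iota_uniq ?mem_index_iota ?xq //=.
rewrite pq; apply: ler_wpDr.
  by apply: sumr_ge0 => p _; case: ifP => // _; apply: sumr_ge0.
rewrite big_ltn ?ltnS // expn1 qn mulr1; apply: ler_wpDr; first exact: sumr_ge0.
have [->|x0] := posnP x; first by rewrite ln0 ?ln_nat_ge0.
by rewrite ler_ln ?posrE ?ltr0n // ler_nat ltnW.
Qed.

Lemma sum_dvd_inv d N : (0 < d)%N ->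
  \sum_(1 <= n < N.+1) (d %| n)%:R / n%:R = d%:R^-1 * harm R (N %/ d).
Proof.
move=> d0; elim: N => [|N IHN]; first by rewrite big_geq // div0n harm0 mulr0.
rewrite big_nat_recr //= IHN divnS //.
have [dN|] /= := boolP (d %| N.+1)%N; last by rewrite mul0r addr0.
rewrite add1n harmS mulrDr; congr (_ + _); rewrite mul1r -invfM -natrM; congr (_%:R^-1).
have -> : (N %/ d).+1 = (N.+1 %/ d)%N by rewrite divnS // dN.
by rewrite mulnC divnK.
Qed.

Lemma sum_dvd d N : (0 < d)%N ->
  (\sum_(1 <= n < N.+1) (d %| n))%N = (N %/ d)%N.
Proof.
move=> d0; elim: N => [|N IHN]; first by rewrite big_geq // div0n.
by rewrite big_nat_recr //= IHN divnS // addnC.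
Qed.

Lemma sum_ppow_log x N (w : nat -> R) :
  \sum_(1 <= n < N.+1) ppow_log x n * w n =
  \sum_(0 <= p < x.+1 | prime p) \sum_(1 <= k < x.+1)
    ln p%:R * \sum_(1 <= n < N.+1) (p ^ k %| n)%:R * w n.
Proof.
under eq_bigr do rewrite big_distrl.
rewrite exchange_big; apply: eq_bigr => p pp.
under eq_bigr do rewrite big_distrl.
rewrite exchange_big; apply: eq_bigr => k _.
by rewrite big_distrr; apply: eq_bigr => n _ /=; rewrite mulrA.
Qed.

End PrimePowers.

Definition smooth x n := all (fun p => p <= x)%N (primes n).

Section SmoothSums.
Variable R : realType.
Implicit Types (n x p k d N : nat).

Definition mertens_sum x : R :=
  \sum_(0 <= p < x.+1 | prime p) \sum_(1 <= k < x.+1)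
    ln p%:R * ((p ^ k <= x)%N%:R / (p ^ k)%N%:R).

Lemma harm_ge0 n : 0 <= harm R n.
Proof. by apply: le_trans (harm_ge R n); rewrite ln_nat_ge0. Qed.

(** Legendre's formula for ln (x!): replacing x %/ p ^ k by x / p ^ k only
    increases the right-hand side. *)
Lemma mertens_sum_ge x : (0 < x)%N -> ln x%:R - 1 <= mertens_sum x.
Proof.
move=> x0; have x0R : 0 < x%:R :> R by rewrite ltr0n.
rewrite -(ler_pM2l x0R) mulrBr mulr1; apply: (le_trans (sum_ln_ge R x)).
rewrite (_ : \sum_(1 <= k < x.+1) _ = \sum_(1 <= n < x.+1) ppow_log R x n * 1).
  rewrite sum_ppow_log mulr_sumr; apply: ler_sum => p pp.
  rewrite mulr_sumr; apply: ler_sum => k _.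
  have pk0 : (0 < p ^ k)%N by rewrite expn_gt0 prime_gt0.
  rewrite mulrCA ler_wpM2l ?ln_nat_ge0 //.
  under eq_bigr do rewrite mulr1.
  rewrite -natr_sum sum_dvd // mulrA.
  have [le|lt] := leqP (p ^ k)%N x; last by rewrite divn_small // mulr0 mul0r.
  by rewrite mulr1 ler_pdivlMr ?ltr0n // -natrM ler_nat leq_divM.
by apply: eq_big_nat => n ?; rewrite ppow_log_eq // mulr1.
Qed.

(** Both harmonic sums are logarithms up to bounded errors, and the two
    occurrences of ln d cancel. *)
Lemma harm_sqr_sub_ge x d : (0 < d <= x)%N ->
  ln x%:R - 1 <= harm R (x ^ 2 %/ d) - harm R (x %/ d).
Proof.
move=> /andP[d0 dx]; have x0 := leq_trans d0 dx.
have q0 : (0 < x %/ d)%N by rewrite divn_gt0.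
have h1 := harm_le R q0; have h2 := harm_ge R (x ^ 2 %/ d).
have [d0R x0R] : 0 < d%:R :> R /\ 0 < x%:R :> R by rewrite !ltr0n.
have h3 : ln (x %/ d)%:R <= ln x%:R - ln d%:R :> R.
  rewrite -ln_div ?posrE // ler_ln ?posrE ?divr_gt0 ?ltr0n //.
  by rewrite ler_pdivlMr // -natrM ler_nat leq_divM.
have h4 : ln x%:R *+ 2 - ln d%:R <= ln (x ^ 2 %/ d).+1%:R :> R.
  rewrite -lnXn // -ln_div ?posrE ?exprn_gt0 // ler_ln ?posrE ?divr_gt0 ?exprn_gt0 ?ltr0n //.
  by rewrite ler_pdivrMr // -natrM -natrX ler_nat ltnW // ltn_ceil.
lra.
Qed.

Lemma sum_ppow_log_inv x N :
  \sum_(1 <= n < N.+1) ppow_log R x n / n%:R =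
  \sum_(0 <= p < x.+1 | prime p) \sum_(1 <= k < x.+1)
    ln p%:R * ((p ^ k)%N%:R^-1 * harm R (N %/ p ^ k)).
Proof.
rewrite sum_ppow_log; apply: eq_bigr => p pp; apply: eq_bigr => k _.
by rewrite sum_dvd_inv // expn_gt0 prime_gt0.
Qed.

(** The sum up to x is exact, since there the restriction on p and k is void;
    passing from x to x^2 lengthens the inner harmonic sum of each p ^ k <= x
    by about ln x, hence adds ln x times Mertens' sum. *)
Lemma sum_ppow_log_sqr_ge x : 1 <= ln x%:R :> R ->
  ln x%:R ^+ 2 / 2 - 1 + (ln x%:R - 1) ^+ 2 <=
  \sum_(1 <= n < (x ^ 2).+1) ppow_log R x n / n%:R.
Proof.
move=> lnx1.
have x0 : (0 < x)%N by case: x lnx1 => // ; rewrite ln0 // ler10.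
have [_ lo] := sqr_ln_bounds R x0.
have lo2 : ln x%:R ^+ 2 / 2 - 1 <= \sum_(1 <= n < x.+1) ppow_log R x n / n%:R.
  rewrite (_ : \sum_(1 <= n < x.+1) _ = \sum_(1 <= n < x.+1) ln n%:R / n%:R); last first.
    by apply: eq_big_nat => n ?; rewrite ppow_log_eq.
  rewrite big_nat_recr //=.
  have : 0 <= x%:R^-1 :> R by rewrite invr_ge0 ler0n.
  have : 0 <= ln x%:R / x%:R :> R by rewrite divr_ge0 ?ln_nat_ge0 ?ler0n.
  lra.
apply: (le_trans (lerD lo2 (lexx _))); rewrite addrC -lerBrDr.
rewrite !sum_ppow_log_inv -sumrB.
apply: (@le_trans _ _ ((ln x%:R - 1) * mertens_sum x)).
  rewrite expr2 ler_wpM2l ?subr_ge0 //; exact: mertens_sum_ge.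
rewrite mulr_sumr; apply: ler_sum => p pp; rewrite mulr_sumr -sumrB.
apply: ler_sum => k _; have pk0 : (0 < p ^ k)%N by rewrite expn_gt0 prime_gt0.
rewrite -!mulrBr mulrCA ler_wpM2l ?ln_nat_ge0 //.
rewrite mulrA mulrC; apply: ler_wpM2l; first by rewrite invr_ge0 ler0n.
have [le|lt] := leqP (p ^ k)%N x; first by rewrite mulr1 harm_sqr_sub_ge // pk0.
by rewrite mulr0 (divn_small lt) harm0 subr0 harm_ge0.
Qed.

(** The terms that are not smooth are bounded by a first moment: each such n
    has at least ln x of its logarithm carried by primes greater than x, and
    the total carried by these primes is at most
    2 (ln x)^2 - (1 / 2 (ln x)^2 + (ln x)^2) up to O(ln x). *)
Lemma smooth_sum_ge x : 1 <= ln x%:R :> R ->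
  3 / 2 * ln x%:R - 3 <= \sum_(1 <= n < (x ^ 2).+1 | smooth x n) n%:R^-1 :> R.
Proof.
move=> lnx1.
have x0 : (0 < x)%N by case: x lnx1 => // ; rewrite ln0 // ler10.
have x20 : (0 < x ^ 2)%N by rewrite expn_gt0 x0.
have x0R : 0 < x%:R :> R by rewrite ltr0n.
have := harm_ge R (x ^ 2).
have : ln x%:R *+ 2 <= ln (x ^ 2).+1%:R :> R.
  by rewrite -lnXn // -natrX ler_ln ?posrE ?ltr0n // ler_nat.
rewrite /harm (bigID (smooth x)) /=.
set S := \sum_(1 <= n < _ | smooth x n) _.
set A := \sum_(1 <= n < _ | _) _ => h1 h2.
have [up _] := sqr_ln_bounds R x20.
have lo := sum_ppow_log_sqr_ge lnx1.
have e2 : ln (x ^ 2)%:R = 2 * ln x%:R :> R by rewrite ln_natX.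
rewrite e2 in up.
have hA : A * ln x%:R + \sum_(1 <= n < (x ^ 2).+1) ppow_log R x n / n%:R <=
    \sum_(1 <= n < (x ^ 2).+1) ln n%:R / n%:R.
  rewrite /A mulr_suml big_mkcond -big_split /=.
  rewrite big_nat_cond [leRHS]big_nat_cond; apply: ler_sum => n /andP[/andP[n0 _] _].
  have ni : 0 <= n%:R^-1 :> R by rewrite invr_ge0 ler0n.
  case: ifPn => [/allPn[q]|_]; last first.
    by rewrite add0r ler_wpM2r // ppow_log_le.
  rewrite mem_primes -ltnNge => /and3P[pq _ qn] xq.
  rewrite mulrC -mulrDl ler_wpM2r // addrC.
  exact: ppow_log_rough xq qn.
have i0 : 0 <= (x ^ 2)%:R^-1 :> R by rewrite invr_ge0 ler0n.
move: up lo hA lnx1 h1 h2 i0; move: ((x ^ 2)%:R^-1) => v.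
move: (\sum_(1 <= n < _) _) (\sum_(1 <= n < _) _) (ln x%:R) (ln (x ^2).+1%:R).
move=> s1 s2 X Y up lo hA X1 h1 h2 i0.
have A1 : A * X <= (X / 2 + 3) * X by nra.
have : A <= X / 2 + 3 by rewrite -(@ler_pM2r _ X) //; lra.
lra.
Qed.

End SmoothSums.

(** * Divisors that stay divisors after multiplication *)

Section DivisorCounts.
Local Open Scope nat_scope.

Definition shift_count P k := count (fun m => m * k %| P) (divisors P).

Lemma dvdn_of_mulr P m k : m * k %| P -> m %| P.
Proof. exact: dvdn_trans (dvdn_mulr k (dvdnn m)). Qed.

(** The divisors m with m p not dividing P are those whose p-adic valuation
    is the valuation a of P; for such m the a + 1 quotients m / p ^ i are divisors of P,
    and they are distinct as m and i vary. *)
Lemma boundary_count P p : 0 < P -> prime p ->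
  (logn p P).+1 * count (fun m => ~~ (m * p %| P)) (divisors P)
    <= size (divisors P).
Proof.
move=> P0 pp; set B := [seq m <- divisors P | ~~ (m * p %| P)].
rewrite -size_filter -/B mulnC -[X in _ * X](size_iota 0) -(size_allpairs (fun m i => m %/ p ^ i)).
have memB m : m \in B -> [/\ 0 < m, m %| P & logn p m = logn p P].
  rewrite mem_filter -dvdn_divisors // => /andP[nd mP].
  have m0 : 0 < m by apply: dvdn_gt0 mP.
  split=> //; apply/eqP; rewrite eqn_leq dvdn_leq_log //= leqNgt.
  apply: contra nd => lt; have /dvdnP[q eP] := mP.
  rewrite eP mulnC dvdn_pmul2r //.
  move: lt; rewrite eP lognM //; last by move: P0; rewrite eP muln_gt0 => /andP[].
  by rewrite -[X in X < _]add0n ltn_add2r logn_gt0 mem_primes => /and3P[].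
have pdv m i : m \in B -> i \in iota 0 (logn p P).+1 -> p ^ i %| m.
  by move=> /memB[m0 _ e]; rewrite mem_iota add0n ltnS -e pfactor_dvdn.
apply: uniq_leq_size.
  apply: allpairs_uniq; [by rewrite filter_uniq ?divisors_uniq | exact: iota_uniq |].
  move=> [m i] [m' i'] /allpairsPdep[a [b [aB bI [-> ->]]]].
  move=> /allpairsPdep[a' [b' [aB' bI' [-> ->]]]] /= e.
  have [[a0 _ ea] [a0' _ ea']] := (memB _ aB, memB _ aB').
  have [da da'] := (pdv _ _ aB bI, pdv _ _ aB' bI').
  have eb : b = b'.
    move: bI bI'; rewrite !mem_iota !add0n !ltnS => bI bI'.
    have := congr1 (logn p) e; rewrite !logn_div // ea ea' !pfactorK //; lia.
  by rewrite -eb -(divnK da) e eb divnK.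
move=> y /allpairsPdep[a [b [aB bI ->]]]; have [a0 aP _] := memB _ aB.
rewrite -dvdn_divisors //; apply: dvdn_trans aP.
by apply/dvdnP; exists (p ^ b); rewrite mulnC divnK // pdv.
Qed.

(** If m k divides P and m k p does not, then m k is one of the divisors
    counted by [boundary_count]. *)
Lemma shift_count_mulr P k p : 0 < P -> 0 < k ->
  shift_count P k <= shift_count P (k * p)
    + count (fun m => ~~ (m * p %| P)) (divisors P).
Proof.
move=> P0 k0; rewrite /shift_count -!size_filter.
set S := [seq m <- divisors P | m * k %| P].
rewrite -(count_predC (fun m => m * (k * p) %| P) S) leq_add //.
  rewrite size_filter count_filter; apply: sub_count => m /= /andP[] //.
rewrite -size_filter -(size_map (fun m => m * k)); apply: uniq_leq_size.
  rewrite map_inj_in_uniq ?filter_uniq ?divisors_uniq // => m m' _ _ /eqP.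
  by rewrite eqn_pmul2r // => /eqP.
move=> y /mapP[m]; rewrite !mem_filter /= => /and3P[nd mk _] ->.
by rewrite -mulnA nd -dvdn_divisors.
Qed.

(** The prime factors of k are removed one at a time; there are at most J of
    them, and each costs at most a proportion 1 / (b + 1) of the divisors. *)
Lemma shift_count_ge P b J k : 0 < P -> 0 < k -> k < 2 ^ J ->
  (forall p, p \in primes k -> b <= logn p P) ->
  b.+1 * size (divisors P) <= b.+1 * shift_count P k + J * size (divisors P).
Proof.
move=> P0; elim: J k => [|J IH] k k0; first by case: k k0.
move=> kJ hk; have [->|k1] := eqVneq k 1.
  rewrite /shift_count (eq_in_count (a2 := predT)) ?count_predT ?leq_addr //.
  by move=> m; rewrite -dvdn_divisors // muln1 => ->.
have k2 : 1 < k by rewrite ltn_neqAle eq_sym k1.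
have pp := pdiv_prime k2; set p := pdiv k in pp.
have pk : p %| k := pdiv_dvd k.
have e : k = k %/ p * p by rewrite divnK.
have q0 : 0 < k %/ p by rewrite divn_gt0 ?prime_gt0 // dvdn_leq.
have qJ : k %/ p < 2 ^ J.
  rewrite ltn_divLR ?prime_gt0 //; apply: (leq_trans kJ).
  by rewrite expnSr leq_mul2l prime_gt1 ?orbT.
have hq p' : p' \in primes (k %/ p) -> b <= logn p' P.
  move=> hp; apply: hk; move: hp; rewrite !mem_primes k0 => /and3P[-> _ d] /=.
  by apply: dvdn_trans d _; apply/dvdnP; exists p; rewrite mulnC divnK.
have := IH _ q0 qJ hq.
have := shift_count_mulr p P0 q0; rewrite -e.
have := boundary_count P0 pp.
have : b <= logn p P by apply: hk; rewrite mem_primes pp k0 pk.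
move: (count _ _) (shift_count P _) (shift_count P k) (size _) (logn p P).
move=> c s1 s2 D a ba h1 h2 h3.
have : b.+1 * c <= D by apply: leq_trans h1; rewrite leq_mul2r ltnS ba orbT.
nia.
Qed.

Definition smooth_modulus x b := \prod_(0 <= p < x.+1 | prime p) p ^ b.

Lemma smooth_modulus_gt0 x b : 0 < smooth_modulus x b.
Proof. by rewrite /smooth_modulus prodn_cond_gt0 // => p pp; rewrite expn_gt0 prime_gt0. Qed.

Lemma logn_smooth_modulus x b p : prime p -> p <= x ->
  b <= logn p (smooth_modulus x b).
Proof.
move=> pp px; rewrite -pfactor_dvdn ?smooth_modulus_gt0 //.
rewrite /smooth_modulus big_mkcond (bigD1_seq p) ?iota_uniq ?mem_index_iota //=.
by rewrite pp dvdn_mulr.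
Qed.

Lemma smooth_modulus_le x b : 0 < x -> smooth_modulus x b <= x ^ (b * x).
Proof.
move=> x0; rewrite /smooth_modulus big_mkcond big_ltn //= mul1n.
apply: (@leq_trans (\prod_(1 <= p < x.+1) x ^ b)).
  rewrite big_nat_cond [X in _ <= X]big_nat_cond; apply: leq_prod => p.
  rewrite andbT ltnS => /andP[_ px]; case: ifP => _; last by rewrite expn_gt0 x0.
  by case: (b) => [|b1]; rewrite ?expn0 ?leq_exp2r.
by rewrite prod_nat_const_nat subSS subn0 -expnM.
Qed.

Lemma smooth_shift_count x b J k : 0 < k -> k < 2 ^ J -> smooth x k ->
  b.+1 * size (divisors (smooth_modulus x b)) <=
  b.+1 * shift_count (smooth_modulus x b) k
    + J * size (divisors (smooth_modulus x b)).
Proof.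
move=> k0 kJ /allP sk; apply: shift_count_ge => //; first exact: smooth_modulus_gt0.
move=> p pk; apply: logn_smooth_modulus; last exact: sk.
by move: pk; rewrite mem_primes => /and3P[].
Qed.

End DivisorCounts.

(** * The ratio of a divisor indicator *)

Lemma sum_shift_count P N k : (0 < P <= N)%N ->
  (\sum_(1 <= m < N.+1) (m * k %| P))%N = shift_count P k.
Proof.
move=> /andP[P0 PN].
transitivity (count (fun m => m * k %| P)%N (index_iota 1 N.+1)).
  by rewrite -sum1_count [RHS]big_mkcond; apply: eq_bigr => m _; case: (_ %| _)%N.
rewrite /shift_count -!size_filter.
apply: perm_size; apply: uniq_perm; rewrite ?filter_uniq ?iota_uniq ?divisors_uniq //.
move=> m; rewrite !mem_filter mem_index_iota -dvdn_divisors //.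
have [mk|//] := boolP (m * k %| P)%N; rewrite /= (dvdn_of_mulr mk).
have mP := dvdn_of_mulr mk.
by rewrite (dvdn_gt0 P0 mP) ltnS (leq_trans _ PN) // dvdn_leq.
Qed.

Section DivisorResonator.
Variable R : realType.

Definition divisor_resonator P (m : nat) : R[i] := real_complex R (m %| P)%:R.

Lemma normc_real (a : R) : ComplexField.Normc.normc (real_complex R a) = `|a|.
Proof. by rewrite /= expr0n addr0 sqrtr_sqr. Qed.

Lemma sqnorm_divisor_resonator T P : (0 < P <= floor_sqrt T)%N ->
  sqnorm_sum T (divisor_resonator P) = (size (divisors P))%:R.
Proof.
move=> PN; have := sum_shift_count 1 PN.
rewrite [in RHS]/shift_count (eq_in_count (a2 := predT)) ?count_predT; last first.
  by move=> m; rewrite muln1 -dvdn_divisors ?(andP PN).1 // => ->.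
move=> <-; rewrite natr_sum; apply: eq_bigr => m _.
by rewrite normc_real muln1; case: (m %| P)%N; rewrite ?normr1 ?normr0 ?expr1n ?expr0n.
Qed.

Lemma resonance_sum_divisor_resonator l T P : (0 < P <= floor_sqrt T)%N ->
  resonance_sum l T (divisor_resonator P) =
  real_complex R (\sum_(1 <= k < (floor_sqrt T).+1)
    ln k%:R ^+ l / k%:R * (shift_count P k)%:R).
Proof.
move=> PN; have /andP[P0 PleN] := PN.
rewrite /resonance_sum; set N := floor_sqrt T in PN PleN *.
transitivity (real_complex R (\sum_(1 <= m < N.+1) \sum_(1 <= k < N.+1)
   ln k%:R ^+ l / k%:R * (m * k %| P)%:R)); last first.
  congr (real_complex R _); rewrite exchange_big; apply: eq_bigr => k _ /=.
  by rewrite -mulr_sumr -natr_sum (sum_shift_count k PN).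
rewrite rmorph_sum; apply: eq_bigr => m _; rewrite rmorph_sum big_mkcond.
apply: eq_bigr => k _.
have [mk|mk] := boolP (m * k %| P)%N; last first.
  rewrite mulr0 rmorph0; case: ifP => // _.
  have -> : divisor_resonator P (m * k) = 0 by rewrite /divisor_resonator (negPf mk).
  by rewrite conjc0 mulr0 !mul0r.
rewrite (leq_trans (dvdn_leq P0 mk) PleN) /divisor_resonator mk (dvdn_of_mulr mk).
rewrite mulr1 [real_complex R true%:R]rmorph1 conjc1 !mul1r.
by rewrite [RHS]fmorph_div [X in _ = _ / X]rmorph_nat mulrC.
Qed.

Lemma divisor_resonance_ratio l T P : (0 < P <= floor_sqrt T)%N ->
  resonance_ratio l T (divisor_resonator P) =
  (\sum_(1 <= k < (floor_sqrt T).+1)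
    ln k%:R ^+ l / k%:R * (shift_count P k)%:R) / (size (divisors P))%:R.
Proof.
move=> PN; rewrite /resonance_ratio resonance_sum_divisor_resonator //.
rewrite sqnorm_divisor_resonator // normc_real ger0_norm //.
by apply: sumr_ge0 => k _; rewrite !mulr_ge0 ?invr_ge0 ?exprn_ge0 ?ln_nat_ge0 ?ler0n.
Qed.

Lemma smooth_resonance_ratio_ge l T x b J :
  (0 < x)%N -> (x ^ 2 <= floor_sqrt T)%N -> (smooth_modulus x b <= floor_sqrt T)%N ->
  (x ^ 2 < 2 ^ J)%N ->
  (1 - J%:R / b.+1%:R) * \sum_(1 <= k < (x ^ 2).+1 | smooth x k) ln k%:R ^+ l / k%:R
   <= resonance_ratio l T (divisor_resonator (smooth_modulus x b)).
Proof.
move=> x0 xN PN xJ; set P := smooth_modulus x b.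
have P0 : (0 < P)%N := smooth_modulus_gt0 x b.
rewrite divisor_resonance_ratio ?P0 //; set D := size (divisors P).
have D0 : (0 < D)%N by rewrite /D lt0n size_eq0; apply/eqP => e; have := divisor1 P; rewrite e.
have w0 k : 0 <= ln k%:R ^+ l / k%:R :> R.
  by rewrite !mulr_ge0 ?invr_ge0 ?exprn_ge0 ?ln_nat_ge0 ?ler0n.
have D0R : 0 < D%:R :> R by rewrite ltr0n.
rewrite ler_pdivlMr //.
rewrite [leRHS](@big_cat_nat _ _ _ (x ^ 2).+1) ?ltnS //=.
apply: ler_wpDr; first by apply: sumr_ge0 => k _; rewrite mulr_ge0 ?w0 ?ler0n.
rewrite -mulrA mulr_suml mulr_sumr [leRHS](bigID (smooth x)) /=.
apply: ler_wpDr; first by apply: sumr_ge0 => k _; rewrite mulr_ge0 ?w0 ?ler0n.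
rewrite big_nat_cond [leRHS]big_nat_cond; apply: ler_sum => k /andP[/andP[k0 kx] sk].
rewrite mulrCA ler_wpM2l ?w0 //.
have := smooth_shift_count b k0 (leq_trans kx xJ) sk.
rewrite -/P -/D -(ler_nat R) natrD !natrM => h.
have b0 : 0 < b.+1%:R :> R by rewrite ltr0n.
rewrite -(ler_pM2l b0) mulrA mulrBr mulr1 mulrCA divff ?gt_eqF // mulr1.
by rewrite mulrBl lerBlDr.
Qed.

(** On the terms with ln k >= t the power is at least t ^ l; the terms with
    ln k < t have total weight at most 1 + t. *)
Lemma smooth_log_sum_ge l x z (t : R) : 0 <= t ->
  t ^+ l * (\sum_(1 <= k < z.+1 | smooth x k) k%:R^-1 - 1 - t)
   <= \sum_(1 <= k < z.+1 | smooth x k) ln k%:R ^+ l / k%:R.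
Proof.
move=> t0; have tl0 : 0 <= t ^+ l by rewrite exprn_ge0.
have i0 k : 0 <= k%:R^-1 :> R by rewrite invr_ge0 ler0n.
have small : \sum_(1 <= k < z.+1 | smooth x k && (ln k%:R < t :> R)) k%:R^-1 <= 1 + t :> R.
  (* ln k < t forces k <= Y, and H_Y <= 1 + ln Y <= 1 + t. *)
  set Y := Num.truncn (expR t).
  have Y1 : (0 < Y)%N by rewrite truncn_ge_nat ?expR_ge0 // -expR0 ler_expR.
  apply: (@le_trans _ _ (harm R Y)).
    rewrite big_mkcond /harm big_nat_cond.
    have -> : \sum_(1 <= k < Y.+1) (k%:R^-1 : R) = \sum_(1 <= k < (maxn Y z).+1) (if (k <= Y)%N then k%:R^-1 else 0).
      by rewrite (big_nat_widen _ _ (maxn Y z).+1) ?ltnS ?leq_maxl // big_mkcond.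
    rewrite [leRHS](@big_cat_nat _ _ _ z.+1) ?ltnS ?leq_maxr //=.
    apply: ler_wpDr; first by apply: sumr_ge0 => k _; case: ifP.
    rewrite [leRHS]big_nat_cond; apply: ler_sum => k /andP[/andP[k0 kz] _].
    case: ifP => [/andP[_ kt]|_]; last by case: ifP.
    rewrite ifT // truncn_ge_nat ?expR_ge0 // -[leLHS]lnK ?posrE ?ltr0n //.
    by rewrite ler_expR ltW.
  apply: (le_trans (harm_le R Y1)); rewrite lerD2l -[leRHS]expRK.
  by rewrite ler_ln ?posrE ?ltr0n ?expR_gt0 // truncn_le ?expR_ge0.
rewrite (bigID (fun k => ln k%:R < t)) [leRHS](bigID (fun k => ln k%:R < t)) /=.
apply: ler_wpDl.
  by apply: sumr_ge0 => k _; rewrite mulr_ge0 ?i0 ?exprn_ge0 ?ln_nat_ge0.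
apply: (@le_trans _ _ (t ^+ l * \sum_(1 <= k < z.+1 | smooth x k && ~~ (ln k%:R < t)) k%:R^-1)).
  by rewrite ler_wpM2l //; lra.
rewrite mulr_sumr; apply: ler_sum => k /andP[_]; rewrite -leNgt => tk.
by rewrite ler_wpM2r // lerXn2r ?nnegrE ?ln_nat_ge0.
Qed.

End DivisorResonator.

(** * The supremum is attained *)

Section MaximumAttained.
Local Open Scope classical_set_scope.
Variable R : realType.

Section ContinuousComplex.
Variable V : topologicalType.
Implicit Types F G : V -> R[i].

(** Continuity through real and imaginary parts, so that real-valued
    continuity lemmas apply and R[i] needs no topology. *)
Definition ccontinuous F :=
  continuous (fun v => complex.Re (F v)) /\ continuous (fun v => complex.Im (F v)).

Lemma ccontinuous_cst z : ccontinuous (fun=> z).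
Proof. by split=> v; exact: cvg_cst. Qed.

Lemma ReD (z w : R[i]) : complex.Re (z + w) = complex.Re z + complex.Re w.
Proof. by case: z w => a b []. Qed.
Lemma ImD (z w : R[i]) : complex.Im (z + w) = complex.Im z + complex.Im w.
Proof. by case: z w => a b []. Qed.
Lemma ReM (z w : R[i]) : complex.Re (z * w) =
  complex.Re z * complex.Re w - complex.Im z * complex.Im w.
Proof. by case: z w => a b []. Qed.
Lemma ImM (z w : R[i]) : complex.Im (z * w) =
  complex.Re z * complex.Im w + complex.Im z * complex.Re w.
Proof. by case: z w => a b []. Qed.

Lemma ccontinuousD F G : ccontinuous F -> ccontinuous G ->
  ccontinuous (fun v => F v + G v).
Proof.
move=> [Fr Fi] [Gr Gi]; split=> v.
  under eq_fun do rewrite ReD; apply: cvgD; [exact: Fr|exact: Gr].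
under eq_fun do rewrite ImD; apply: cvgD; [exact: Fi|exact: Gi].
Qed.

Lemma ccontinuousM F G : ccontinuous F -> ccontinuous G ->
  ccontinuous (fun v => F v * G v).
Proof.
move=> [Fr Fi] [Gr Gi]; split=> v.
  under eq_fun do rewrite ReM.
  apply: cvgB; apply: cvgM; by [exact: Fr|exact: Gr|exact: Fi|exact: Gi].
under eq_fun do rewrite ImM.
apply: cvgD; apply: cvgM; by [exact: Fr|exact: Gr|exact: Fi|exact: Gi].
Qed.

Lemma ccontinuous_conj F : ccontinuous F -> ccontinuous (fun v => conjc (F v)).
Proof.
move=> [Fr Fi]; split=> v.
  by rewrite (_ : (fun v => _) = fun v => complex.Re (F v)); [exact: Fr|apply/funext => w; case: (F w)].
rewrite (_ : (fun v => _) = fun v => - complex.Im (F v)); first by apply: cvgN; exact: Fi.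
by apply/funext => w; case: (F w).
Qed.

Lemma ccontinuous_sum (s : seq nat) (P : pred nat) (F : nat -> V -> R[i]) :
  (forall i, ccontinuous (F i)) -> ccontinuous (fun v => \sum_(i <- s | P i) F i v).
Proof.
move=> cF; elim: s => [|i s IH].
  by under eq_fun do rewrite big_nil; exact: ccontinuous_cst.
by case Pi: (P i); under eq_fun do rewrite big_cons Pi; [exact: ccontinuousD|].
Qed.

Lemma normcE (z : R[i]) :
  ComplexField.Normc.normc z = Num.sqrt (complex.Re z ^+ 2 + complex.Im z ^+ 2).
Proof. by case: z. Qed.

Lemma continuous_normc F : ccontinuous F ->
  continuous (fun v => ComplexField.Normc.normc (F v)).
Proof.
move=> [Fr Fi] v; under eq_fun do rewrite normcE.
apply: continuous_comp; last exact: sqrt_continuous.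
apply: cvgD; apply: cvgM; by [exact: Fr|exact: Fi].
Qed.

Lemma continuous_sum_normc_sqr (s : seq nat) (F : nat -> V -> R[i]) :
  (forall i, ccontinuous (F i)) ->
  continuous (fun v => \sum_(i <- s) ComplexField.Normc.normc (F i v) ^+ 2).
Proof.
move=> cF; elim: s => [|i s IH] v.
  by under eq_fun do rewrite big_nil; exact: cvg_cst.
under eq_fun do rewrite big_cons; apply: cvgD; last exact: IH.
by apply: cvgM; apply: continuous_normc.
Qed.

End ContinuousComplex.

Definition coord_fun N (v : 'rV[R]_(N.+1 + N).+1) (n : nat) : R[i] :=
  Complex (v ord0 (inord n)) (v ord0 (inord (N.+1 + n))).

Lemma ccontinuous_coord_fun N n : ccontinuous (fun v => @coord_fun N v n).
Proof. by split => v; exact: coord_continuous. Qed.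

Lemma resonance_sumZ l T c (r : nat -> R[i]) :
  resonance_sum l T (fun n => real_complex R c * r n) =
  real_complex R (c ^+ 2) * resonance_sum l T r.
Proof.
rewrite /resonance_sum mulr_sumr; apply: eq_bigr => m _.
rewrite mulr_sumr; apply: eq_bigr => k _.
have conjM (z w : R[i]) : conjc (z * w) = conjc z * conjc w by exact: rmorphM.
rewrite conjM conjc_real [real_complex R (c ^+ 2)]rmorphXn expr2 !mulrA; do 3 congr (_ * _).
by rewrite mulrAC.
Qed.

Lemma sqnorm_sumZ T c (r : nat -> R[i]) :
  sqnorm_sum T (fun n => real_complex R c * r n) = c ^+ 2 * sqnorm_sum T r.
Proof.
rewrite /sqnorm_sum mulr_sumr; apply: eq_bigr => n _.
by rewrite ComplexField.Normc.normcM normc_real exprMn real_normK ?num_real.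
Qed.

Lemma eq_sqnorm_sum T (r s : nat -> R[i]) :
  (forall n, (0 < n <= floor_sqrt T)%N -> r n = s n) -> sqnorm_sum T r = sqnorm_sum T s.
Proof. by move=> rs; apply: eq_big_nat => n n1N; rewrite rs. Qed.

Lemma eq_resonance_sum l T (r s : nat -> R[i]) :
  (forall n, (0 < n <= floor_sqrt T)%N -> r n = s n) ->
  resonance_sum l T r = resonance_sum l T s.
Proof.
move=> rs; apply: eq_big_nat => m mN.
rewrite big_nat_cond [RHS]big_nat_cond; apply: eq_bigr => k /andP[/andP[k0 _] mk].
by have /andP[m0 _] := mN; rewrite !rs // muln_gt0 m0 k0.
Qed.

Lemma sqnorm_sum_ge0 T (r : nat -> R[i]) : 0 <= sqnorm_sum T r.
Proof. by apply: sumr_ge0 => n _; rewrite exprn_ge0 ?normcE ?sqrtr_ge0. Qed.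

(** The ratio is invariant under scaling, so the maximum may be sought on the
    unit sphere; the value at 0 does not enter the norm, whence the additional
    restriction to a box that makes the set compact. *)
Lemma max_ratio_exists l (T : R) : (0 < floor_sqrt T)%N -> exists M, is_max_ratio l T M.
Proof.
move=> N0; set N := floor_sqrt T in N0.
pose box := [set v : 'rV[R]_(N.+1 + N).+1 | forall i, v ord0 i \in `[(-1), 1]%R].
pose sphere := [set v : 'rV[R]_(N.+1 + N).+1 | sqnorm_sum T (coord_fun v) = 1].
have cbox : compact box.
  rewrite /box; apply: (@rV_compact R _ (fun=> `[(-1), 1]%classic)) => _.
  exact: segment_compact.
have csq : continuous (fun v => sqnorm_sum T (@coord_fun N v)).
  by apply: continuous_sum_normc_sqr => n; exact: ccontinuous_coord_fun.
have cres : continuous (fun v => ComplexField.Normc.normc (resonance_sum l T (@coord_fun N v))).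
  apply: continuous_normc; apply: ccontinuous_sum => m; apply: ccontinuous_sum => k.
  apply: ccontinuousM; last exact: ccontinuous_cst.
  apply: ccontinuousM; last exact: ccontinuous_cst.
  apply: ccontinuousM; first exact: ccontinuous_coord_fun.
  by apply: ccontinuous_conj; exact: ccontinuous_coord_fun.
have csphere : closed sphere.
  by apply: (@closed_comp _ _ (fun v => sqnorm_sum T (@coord_fun N v)) [set 1]) => //.
have cA : compact (box `&` sphere) by apply: compact_closedI.
have norm_lift (r : nat -> R[i]) : sqnorm_sum T r != 0 -> exists2 v, (box `&` sphere) v &
   resonance_ratio l T r = ComplexField.Normc.normc (resonance_sum l T (coord_fun v)).
  move=> rn0; have s0 : 0 < sqnorm_sum T r by rewrite lt_neqAle eq_sym rn0 sqnorm_sum_ge0.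
  pose c := (Num.sqrt (sqnorm_sum T r))^-1.
  have c2 : c ^+ 2 = (sqnorm_sum T r)^-1 by rewrite /c exprVn sqr_sqrtr // ltW.
  pose r1 n := real_complex R c * r n.
  (* Values outside the range are reset to 0 to land in the box. *)
  pose r2 n := if (0 < n <= N)%N then r1 n else 0.
  have sq1 : sqnorm_sum T r1 = 1 by rewrite sqnorm_sumZ c2 mulVf.
  have sq2 : sqnorm_sum T r2 = 1.
    by rewrite -sq1; apply: eq_sqnorm_sum => n n1N; rewrite /r2 n1N.
  have le1 n : ComplexField.Normc.normc (r2 n) ^+ 2 <= 1.
    rewrite /r2; case: ifPn => [nN|_]; last by rewrite normcE /= expr0n addr0 sqrtr0 expr0n ler01.
    rewrite -sq1 /sqnorm_sum (bigD1_seq n) ?iota_uniq ?mem_index_iota //= ler_wpDr //.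
    by apply: sumr_ge0 => i _; rewrite exprn_ge0 ?normcE ?sqrtr_ge0.
  have norm2 z : ComplexField.Normc.normc z ^+ 2 = complex.Re z ^+ 2 + complex.Im z ^+ 2 :> R.
    by rewrite normcE sqr_sqrtr // addr_ge0 ?sqr_ge0.
  have sq_itv (a : R) : a ^+ 2 <= 1 -> a \in `[(-1), 1]%R.
    by move=> a1; rewrite in_itv /= -ler_norml -(@ler_pXn2r _ 2) ?nnegrE // real_normK ?num_real // expr1n.
  pose v : 'rV[R]_(N.+1 + N).+1 := \row_j
    if (j <= N)%N then complex.Re (r2 j) else complex.Im (r2 (j - N.+1)%N).
  have vr2 n : (0 < n <= N)%N -> coord_fun v n = r2 n.
    move=> /andP[n0 nN]; rewrite /coord_fun !mxE !inordK; [|lia|lia].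
    rewrite nN ifF; last lia.
    by rewrite addKn; case: (r2 n).
  exists v.
    split=> /=; last by rewrite /sphere /= -sq2; apply: eq_sqnorm_sum.
    move=> i; apply: sq_itv; rewrite mxE; case: ifP => _.
      by apply: le_trans (le1 i); rewrite norm2 ler_wpDr ?sqr_ge0.
    by apply: le_trans (le1 (i - N.+1)%N); rewrite norm2 ler_wpDl ?sqr_ge0.
  rewrite (@eq_resonance_sum _ _ (coord_fun v) r1); last first.
    by move=> n nN; rewrite vr2 // /r2 nN.
  rewrite resonance_sumZ ComplexField.Normc.normcM normc_real ger0_norm ?sqr_ge0 //.
  by rewrite c2 mulrC.
have ne : (box `&` sphere) !=set0.
  have [|v vA _] := norm_lift (fun=> 1); last by exists v.
  rewrite /sqnorm_sum ComplexField.Normc.normc1; under eq_bigr do rewrite expr1n.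
  by rewrite sumr_const_nat subn1 pnatr_eq0 -lt0n.
have [v /set_mem[vbox vsph] vmax] := compact_EVT_max ne cA (continuous_subspaceT cres).
exists (resonance_ratio l T (coord_fun v)); split.
  by exists (coord_fun v) => //; rewrite vsph oner_eq0.
move=> r /norm_lift[w wA ->]; rewrite /resonance_ratio vsph divr1.
exact: vmax (mem_set wA).
Qed.

End MaximumAttained.

(** * Choice of the parameters *)

Section Thresholds.
Variable R : realType.

(** x is the integer part of (ln T)^(99/100), J exceeds the binary logarithm
    of x^2 and b = 100 J.  As J = O(V), the logarithm of x ^ (b x) is
    O(V^2 exp (99/100 V)), which is smaller than exp V / 2 for large V. *)
Lemma resonator_parameters (T V : R) : T = expR (expR V) -> 6 * 1000 * 1000 * 1000 <= V ->
  exists x b J : nat,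
    [/\ (0 < x)%N, (x ^ 2 <= floor_sqrt T)%N /\ (smooth_modulus x b <= floor_sqrt T)%N,
        (x ^ 2 < 2 ^ J)%N, (100 * J <= b)%N & 99 / 100 * V - 1 <= ln x%:R].
Proof.
move=> eT V0.
pose y := expR (99 / 100 * V).
have y1 : 1 + 99 / 100 * V <= y by exact: expR_ge1Dx.
pose x := Num.truncn y.
have y0 : 0 <= y by exact: expR_ge0.
have xy : x%:R <= y by rewrite truncn_le.
have yx : y < x%:R + 1 by rewrite natr1 truncnS_gt.
have x2 : 2 < x%:R :> R by lra.
have x0R : 0 < x%:R :> R by lra.
have x0 : (0 < x)%N by rewrite -(ltr0n R).
have lnx_le : ln x%:R <= V.
  apply: (@le_trans _ _ (99 / 100 * V)); last by lra.
  by rewrite -[leRHS]expRK ler_ln // posrE expR_gt0.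
have lnx_ge : 99 / 100 * V - 1 <= ln x%:R.
  rewrite -[leLHS]expRK ler_ln ?posrE ?expR_gt0 // expRD -/y.
  have e1 : expR (- 1) <= 1 / 2 :> R.
    have := expR_ge1Dx (1 : R).
    have := expRxMexpNx_1 (1 : R); have := expR_gt0 (- 1 : R); nra.
  apply: (@le_trans _ _ (y * (1 / 2))); first by rewrite ler_wpM2l.
  lra.
pose J := (trunc_log 2 (x ^ 2)).+1.
have xJ : (x ^ 2 < 2 ^ J)%N by exact: trunc_log_ltn.
have J5 : J%:R <= 5 * V.
  have h : (2 ^ trunc_log 2 (x ^ 2) <= x ^ 2)%N by apply: trunc_logP; rewrite ?expn_gt0 ?x0.
  have : ln (2 ^ trunc_log 2 (x ^ 2))%N%:R <= ln (x ^ 2)%N%:R :> R.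
    by rewrite ler_ln ?posrE ?ltr0n ?expn_gt0 ?x0 // ler_nat.
  rewrite !ln_natX // /J -(natr1 (trunc_log 2 (x ^ 2))).
  have := @lnS_sub_ge R 1 isT; rewrite ln1 subr0.
  have : 0 <= (trunc_log 2 (x ^ 2))%:R :> R by rewrite ler0n.
  move: (trunc_log 2 (x ^ 2))%:R (ln 2%:R) => j u j0 u2 ju.
  have : j * 2%:R^-1 <= j * u by rewrite ler_wpM2l.
  lra.
pose b := (100 * J)%N.
have PN : (x ^ (b * x) <= floor_sqrt T)%N.
  rewrite truncn_ge_nat ?sqrtr_ge0 // -[leLHS]lnK ?posrE ?ltr0n ?expn_gt0 ?x0 //.
  have -> : Num.sqrt T = expR (expR V / 2).
    rewrite eT -[RHS]ger0_norm ?expR_ge0 // -sqrtr_sqr -expRM_natr.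
    by congr (Num.sqrt (expR _)); field.
  rewrite ler_expR ln_natX // natrM /b natrM.
  have eV : expR V = y * expR (V / 100) by rewrite -expRD; congr expR; field.
  (* (V / 100)^3 / 6 >= 1000 V^2 is where the lower bound on V comes from. *)
  have big : 1000 * V ^+ 2 <= expR (V / 100).
    apply: le_trans (@expR_ge1Dxn R (V / 100) 2 _); last by lra.
    rewrite (_ : 3`! = 6)%N // expr_div_n.
    have -> : V ^+ 3 = V * V ^+ 2 by rewrite exprS.
    have : 0 <= V ^+ 2 by rewrite sqr_ge0.
    nra.
  have h1 : 100%:R * J%:R * x%:R <= 500 * V * y.
    apply: ler_pM; rewrite ?mulr_ge0 ?ler0n //; lra.
  have h2 : 100%:R * J%:R * x%:R * ln x%:R <= 500 * V * y * V.
    by apply: ler_pM; rewrite ?mulr_ge0 ?ler0n ?ln_nat_ge0.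
  apply: (le_trans h2); rewrite eV.
  have : y * (1000 * V ^+ 2) <= y * expR (V / 100) by rewrite ler_wpM2l.
  move: (y * expR (V / 100)) => w; rewrite expr2; lra.
exists x, b, J; split => //; split; last exact: leq_trans (smooth_modulus_le _ x0) PN.
apply: leq_trans PN; rewrite leq_pexp2l // /b /J.
by rewrite -mulnA (@leq_mul 2 1) // muln_gt0 x0.
Qed.

(** The value of t ^ l (B - t) at its maximum t = l / (l + 1) * B. *)
Lemma optimal_cutoff l (B : R) : (0 < l)%N ->
  (l%:R / (l%:R + 1) * B) ^+ l * (B - l%:R / (l%:R + 1) * B) =
  l%:R^-1 * (l%:R / (l%:R + 1)) ^+ l.+1 * B ^+ l.+1.
Proof.
move=> l0; have l0R : l%:R != 0 :> R by rewrite pnatr_eq0 -lt0n.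
have l1R : l%:R + 1 != 0 :> R by rewrite natr1 pnatr_eq0.
rewrite exprMn !exprSr; move: ((l%:R / (l%:R + 1)) ^+ l) (B ^+ l) => u v.
by field; apply/andP.
Qed.

(** Since l + 1 >= 2 it is enough that 99 / 100 * (29 / 20)^2 > 41 / 20.  The
    constant 29 / 20 is 3 / 2 * 99 / 100 lowered so as to absorb the additive
    constants when V is large. *)
Lemma growth_gap l (L V B : R) : (0 < l)%N -> 0 <= L -> L <= V -> 29 / 20 * V <= B ->
  expR (euler_gamma R) * L ^+ l.+1 <= 99 / 100 * B ^+ l.+1.
Proof.
move=> l0 L0 LV VB; have V0 := le_trans L0 LV.
have g := expR_euler_gamma_le R.
apply: (@le_trans _ _ (41 / 20 * V ^+ l.+1)).
  by apply: ler_pM; rewrite ?expR_ge0 ?exprn_ge0 // lerXn2r.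
apply: (@le_trans _ _ (99 / 100 * (29 / 20 * V) ^+ l.+1)); last first.
  by rewrite ler_wpM2l // ?lerXn2r ?nnegrE //; lra.
rewrite exprMn mulrA ler_wpM2r ?exprn_ge0 //.
apply: (@le_trans _ _ (99 / 100 * (29 / 20) ^+ 2)); first by rewrite expr2; lra.
by rewrite ler_wpM2l ?ler_weXn2l //; lra.
Qed.

Lemma loss_factor_ge (J b : nat) : (100 * J <= b)%N ->
  99 / 100 <= 1 - J%:R / b.+1%:R :> R.
Proof.
move=> Jb; have : J%:R / b.+1%:R <= 1 / 100 :> R; last first.
  by move: (J%:R / b.+1%:R) => u; lra.
rewrite ler_pdivrMr ?ltr0n // div1r mulrC ler_pdivlMr // -natrM ler_nat mulnC.
exact: leqW.
Qed.

End Thresholds.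

Theorem proposition1 (R : realType) :
  exists (C T0 : R) (E : R -> nat -> R),
    forall (T : R) (l : nat), T0 <= T -> (0 < l)%N ->
      `|E T l| <= C /\
      exists2 M : R, is_max_ratio l T M &
        M >= expR (euler_gamma R) / l%:R * (l%:R / (l%:R + 1)) ^+ l.+1
             * (ln (ln T) - ln (ln (ln T)) + E T l) ^+ l.+1.
Proof.
exists 0, (expR (expR (6 * 1000 * 1000 * 1000))), (fun _ _ => 0) => T l T0 l0.
split; first by rewrite normr0.
pose V := ln (ln T).
have Tgt0 : 0 < T := lt_le_trans (expR_gt0 _) T0.
have lnT : expR (6 * 1000 * 1000 * 1000) <= ln T.
  by rewrite -[leLHS]expRK ler_ln ?posrE ?expR_gt0.
have lnT0 : 0 < ln T := lt_le_trans (expR_gt0 _) lnT.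
have V0 : 6 * 1000 * 1000 * 1000 <= V by rewrite -[leLHS]expRK ler_ln ?posrE ?expR_gt0.
have eT : T = expR (expR V) by rewrite /V !lnK ?posrE.
have [x [b [J [x0 [xN PN] xJ Jb lnx]]]] := resonator_parameters eT V0.
have V1 : 1000 <= V.
  by apply: le_trans V0; lra.
clear V0 lnT T0.
have [|M Mmax] := @max_ratio_exists R l T.
  by apply: leq_trans xN; rewrite expn_gt0 x0.
exists M => //; rewrite addr0 -/V.
set P := smooth_modulus x b in PN.
have P0 : (0 < P)%N := smooth_modulus_gt0 x b.
have ratioM : resonance_ratio l T (divisor_resonator R P) <= M.
  apply: Mmax.2; rewrite sqnorm_divisor_resonator ?P0 //.
  by rewrite pnatr_eq0 size_eq0; apply/eqP => e; have := divisor1 P; rewrite e.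
apply: le_trans ratioM.
apply: le_trans (smooth_resonance_ratio_ge l x0 xN PN xJ).
have lnx1 : 1 <= ln x%:R :> R by lra.
have S_ge := smooth_sum_ge lnx1.
set S := \sum_(1 <= n < _ | _) _ in S_ge.
pose B := S - 1.
have VB : 29 / 20 * V <= B by rewrite /B; lra.
have B0 : 0 <= B by lra.
have l0R : 0 < l%:R :> R by rewrite ltr0n.
pose t := l%:R / (l%:R + 1) * B.
have q0 : 0 <= l%:R / (l%:R + 1) :> R by rewrite divr_ge0 //; lra.
have t0 : 0 <= t by rewrite mulr_ge0.
have main := smooth_log_sum_ge l x (x ^ 2) t0.
rewrite -/S -/B optimal_cutoff // in main.
have J1 := loss_factor_ge R Jb.
have gap := @growth_gap R l (V - ln V) V B l0.
have lnV0 : 0 <= ln V by rewrite ln_ge0 //; lra.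
have lnVV : ln V <= V by apply/ltW/ln_sublinear; lra.
have {}gap := gap _ _ VB.
apply: (@le_trans _ _ (99 / 100 * (l%:R^-1 * (l%:R / (l%:R + 1)) ^+ l.+1 * B ^+ l.+1))).
  have {}gap : expR (euler_gamma R) * (V - ln V) ^+ l.+1 <= 99 / 100 * B ^+ l.+1.
    by apply: gap; lra.
  set q := (l%:R / (l%:R + 1)) ^+ l.+1.
  have lq0 : 0 <= l%:R^-1 * q by rewrite mulr_ge0 ?invr_ge0 ?exprn_ge0 // ltW.
  have := ler_wpM2l lq0 gap.
  by congr (_ <= _); [rewrite mulrA; congr (_ * _); rewrite mulrC mulrA|rewrite mulrCA].
apply: ler_pM => //; first by rewrite !mulr_ge0 ?invr_ge0 ?exprn_ge0 // ltW.
Qed.
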